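(* Let $\mathsf{Most}(F,G)$ be the generalized quantifier $|F\cap G|>|F\setminus G|$ and $\mathsf{More\text{-}than}(F,G,H)$ the generalized quantifier $|F\cap H|>|G\cap H|$ ($F,G,H$ unary). (1) $\mathsf{Most}$ and $\mathsf{More\text{-}than}$ are bounded $\Delta^1_1$-definable relative to $\Sigma^1_1\text{-}\mathsf{CA}_0^{\mathsf{fin}}$. (2) $\mathsf{Most}$ and $\mathsf{More\text{-}than}$ are Henkin domain independent and Henkin conservative relative to $\Sigma^1_1\text{-}\mathsf{CA}_0^{\mathsf{fin}}$.
   Context: Language: second-order logic with individual variables and, for each $n\ge1$, $n$-ary relation variables, identity, atomic formulas $R\overline x$, and one binary relation symbol $\preceq$ on individuals. The language also contains, as primitive symbols with their usual (first-order definable) meaning, $\emptyset,\subseteq,\cap,\cup,\setminus,\times,X^n$, projections and fields of relations. A formula is first-order if it has no second-order quantifiers; it is $\Sigma^1_1$ (resp. $\Pi^1_1$) if it is a block of existential (resp. universal) second-order quantifiers followed by a first-order formula. Henkin model: $\mathcal A=(A,S_1[A],S_2[A],\ldots;\preceq^{\mathcal A})$ with $A\neq\emptyset$, $\emptyset\neq S_n[A]\subseteq P(A^n)$, $\preceq^{\mathcal A}\subseteq A^2$; $n$-ary relation variables range over $S_n[A]$; $R\overline a$ means $\overline a\in R$. Provability is many-sorted first-order provability, equivalently truth in all Henkin models of the theory. $\mathcal A$ is a substructure of $\mathcal B$ if $A\subseteq B$, $S_n[A]\subseteq S_n[B]$ for all $n$, and $\preceq^{\mathcal B}\cap A^2=\preceq^{\mathcal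 A}$. Cardinality in second-order logic: functions $f:X\to Y$ are identified with their graphs (binary relations contained in $X\times Y$). $|X|\le|Y|$ means there is an injection $f:X\to Y$; $|X|<|Y|$ (equivalently $|Y|>|X|$) means $|X|\le|Y|$ and not $|Y|\le|X|$. $X$ is Dedekind infinite if there is an injective non-surjective $f:X\to X$, and Dedekind finite otherwise. $\Sigma^1_1\text{-}\mathsf{CA}_0^{\mathsf{fin}}$ consists of: extensionality for each arity; comprehension $\exists R\,\forall\overline x\,(R\overline x\leftrightarrow\varphi(\overline x))$ for all $\Sigma^1_1$ formulas $\varphi$ (which may contain $\preceq$ and parameters; $R$ not free in $\varphi$); axioms saying $\preceq$ is a well-order of the individuals (reflexive, antisymmetric, transitive, linear, and every non-empty unary $X$ has a $\preceq$-least element); and the axiom that the universe $\mathbb V=\{x:x=x\}$ is Dedekind finite. The free variables of each quantifier are split into $\overline R$ and $\overline R'$: for $\mathsf{Most}$, $\overline R=F$ and $\overline R'=G$; for $\mathsf{More\text{-}than}$, $\overline R=(F,G)$ and $\overline R'=H$. As these are unary, the field $\mathscr U\overline R$ is $F$, respectively $F\cup G$. Binding: for a unary term $X$, $\varphi^X$ restricts each first-order quantifier of $\varphi$ to elements of $X$ and each $n$-ary second-order quantifier to subsets of $X^n$. $Q(\overline R,\overline R')$ is bounded $\Delta^1_1$-definable relative to $T$ if there are a $\Sigma^1_1$ formula $\Phi(\overline R,\overline R')$ and a $\Pi^1_1$ formula $\Psi(\overline R,\overline R')$, with all free variables displayed, such that $T$ proves $\forall\overline R\,\forall\overline R'(Q(\overline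 R,\overline R')\leftrightarrow\Phi^{\mathscr U\overline R}(\overline R,\overline R'))$ and the same with $\Psi$ in place of $\Phi$. $Q$ is Henkin domain independent relative to $T$ if for all Henkin models $\mathcal A,\mathcal B$ of $T$ with $\mathcal A$ a substructure of $\mathcal B$ and all arguments from $\mathcal A$, $\mathcal A\models Q$ iff $\mathcal B\models Q$ at those arguments. $Q$ is Henkin conservative relative to $T$ if $T$ proves $\forall\overline R\,\forall\overline R'(Q(\overline R,\overline R')\leftrightarrow Q(\overline R,\mathscr U\overline R\cap\overline R'))$. *)

(* Defs.v *)
From mathcomp Require Import all_boot.
From mathcomp Require Import boolp classical_sets.

Set Implicit Arguments.
Unset Strict Implicit.
Unset Printing Implicit Defensive.

Local Open Scope classical_set_scope.

(* Variables are named by natural numbers.  Arities are at least 1: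
   RVar n k is the k-th relation variable of arity n.+1.                      *)
Inductive rterm : nat -> Type :=
| RVar (n k : nat) : rterm n.+1
| REmpty (n : nat) : rterm n.+1
| RInter (n : nat) : rterm n -> rterm n -> rterm n
| RUnion (n : nat) : rterm n -> rterm n -> rterm n
| RDiff (n : nat) : rterm n -> rterm n -> rterm n
| RProd (m n : nat) : rterm m -> rterm n -> rterm (m + n)
| RPow (n : nat) : rterm 1 -> rterm n.+1
| RProj (n : nat) : 'I_n -> rterm n -> rterm 1
| RField (n : nat) : rterm n -> rterm 1.

Arguments REmpty : clear implicits.
Arguments RPow : clear implicits.

(* FAll2 n k and FEx2 n k bind the relation variable RVar n k. *)
Inductive formula : Type :=
| FEq (x y : nat)
| FLe (x y : nat)
| FApp (n : nat) (R : rterm n) (xs : n.-tuple nat)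
| FEqR (n : nat) (R1 R2 : rterm n)
| FSub (n : nat) (R1 R2 : rterm n)
| FNot (p : formula)
| FAnd (p q : formula)
| FOr (p q : formula)
| FImp (p q : formula)
| FAll1 (x : nat) (p : formula)
| FEx1 (x : nat) (p : formula)
| FAll2 (n k : nat) (p : formula)
| FEx2 (n k : nat) (p : formula).

Definition FIff (p q : formula) : formula := FAnd (FImp p q) (FImp q p).

Definition FApp1 (X : rterm 1) (x : nat) : formula := FApp X [tuple x].
Definition FApp2 (R : rterm 2) (x y : nat) : formula := FApp R [tuple x; y].

Definition all1s (xs : seq nat) (p : formula) : formula := foldr FAll1 p xs.

Fixpoint first_order (p : formula) : bool :=
  match p with
  | FEq _ _ | FLe _ _ | FApp _ _ _ | FEqR _ _ _ | FSub _ _ _ => true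
  | FNot p => first_order p
  | FAnd p q | FOr p q | FImp p q => first_order p && first_order q
  | FAll1 _ p | FEx1 _ p => first_order p
  | FAll2 _ _ _ | FEx2 _ _ _ => false
  end.

Fixpoint sigma11 (p : formula) : bool :=
  if p is FEx2 _ _ q then sigma11 q else first_order p.

Fixpoint pi11 (p : formula) : bool :=
  if p is FAll2 _ _ q then pi11 q else first_order p.

Fixpoint rocc (n k : nat) (m : nat) (R : rterm m) : bool :=
  match R with
  | RVar n' k' => (n == n') && (k == k')
  | REmpty _ => false
  | RInter _ R1 R2 | RUnion _ R1 R2 | RDiff _ R1 R2 => rocc n k R1 || rocc n k R2
  | RProd _ _ R1 R2 => rocc n k R1 || rocc n k R2
  | RPow _ X => rocc n k X
  | RProj _ _ R => rocc n k R
  | RField _ R => rocc n k R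
  end.

Fixpoint free1 (x : nat) (p : formula) : bool :=
  match p with
  | FEq y z | FLe y z => (x == y) || (x == z)
  | FApp _ _ ys => x \in (ys : seq nat)
  | FEqR _ _ _ | FSub _ _ _ => false
  | FNot p => free1 x p
  | FAnd p q | FOr p q | FImp p q => free1 x p || free1 x q
  | FAll1 y p | FEx1 y p => (x != y) && free1 x p
  | FAll2 _ _ p | FEx2 _ _ p => free1 x p
  end.

Fixpoint free2 (n k : nat) (p : formula) : bool :=
  match p with
  | FEq _ _ | FLe _ _ => false
  | FApp _ R _ => rocc n k R
  | FEqR _ R1 R2 | FSub _ R1 R2 => rocc n k R1 || rocc n k R2
  | FNot p => free2 n k p
  | FAnd p q | FOr p q | FImp p q => free2 n k p || free2 n k q
  | FAll1 _ p | FEx1 _ p => free2 n k p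
  | FAll2 n' k' p | FEx2 n' k' p => ((n, k) != (n', k')) && free2 n k p
  end.

Fixpoint binds2 (n k : nat) (p : formula) : bool :=
  match p with
  | FEq _ _ | FLe _ _ | FApp _ _ _ | FEqR _ _ _ | FSub _ _ _ => false
  | FNot p => binds2 n k p
  | FAnd p q | FOr p q | FImp p q => binds2 n k p || binds2 n k q
  | FAll1 _ p | FEx1 _ p => binds2 n k p
  | FAll2 n' k' p | FEx2 n' k' p => ((n, k) == (n', k')) || binds2 n k p
  end.

(* p^X.  Only meaningful when p binds no relation variable of X, since
   otherwise the occurrences of X introduced here would be captured.          *)
Fixpoint bound (X : rterm 1) (p : formula) : formula :=
  match p with
  | FNot p => FNot (bound X p)
  | FAnd p q => FAnd (bound X p) (bound X q)
  | FOr p q => FOr (bound X p) (bound X q)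
  | FImp p q => FImp (bound X p) (bound X q)
  | FAll1 x p => FAll1 x (FImp (FApp1 X x) (bound X p))
  | FEx1 x p => FEx1 x (FAnd (FApp1 X x) (bound X p))
  | FAll2 n k p => FAll2 n k (FImp (FSub (RVar n k) (RPow n X)) (bound X p))
  | FEx2 n k p => FEx2 n k (FAnd (FSub (RVar n k) (RPow n X)) (bound X p))
  | FEq _ _ | FLe _ _ | FApp _ _ _ | FEqR _ _ _ | FSub _ _ _ => p
  end.

(* The structures considered have their domain inside an ambient type T, so
   that a substructure is literally a subset.  rels n is S_{n+1}.             *)
Record henkin (T : Type) : Type := Henkin {
  dom : set T;
  rels : forall n : nat, set (set (n.+1.-tuple T));
  le : T -> T -> Prop;
  dom_neq0 : dom !=set0;
  rels_neq0 : forall n, @rels n !=set0;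
  rels_sub : forall n (R : set (n.+1.-tuple T)), @rels n R ->
    R `<=` [set t | forall i, dom (tnth t i)];
  le_dom : forall x y, le x y -> dom x /\ dom y
}.

Arguments rels {T} h n _ : rename.

Definition substructure (T : Type) (A B : henkin T) : Prop :=
  [/\ dom A `<=` dom B,
      forall n, rels A n `<=` rels B n
    & forall x y, dom A x -> dom A y -> (le B x y <-> le A x y)].

Definition ienv (T : Type) := nat -> T.
Definition renv (T : Type) := forall n : nat, nat -> set (n.+1.-tuple T).

Definition upd1 (T : Type) (e : ienv T) (x : nat) (a : T) : ienv T :=
  fun y => if y == x then a else e y.

Definition upd2 (T : Type) (r : renv T) (n k : nat) (R : set (n.+1.-tuple T)) :
    renv T :=
  dfwith r (fun j => if j == k then R else r n j).

Arguments upd2 {T} r {n} k R _ _ _.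

Fixpoint reval (T : Type) (r : renv T) (n : nat) (R : rterm n) :
    set (n.-tuple T) :=
  match R in rterm n return set (n.-tuple T) with
  | RVar n k => r n k
  | REmpty n => set0
  | RInter _ R1 R2 => reval r R1 `&` reval r R2
  | RUnion _ R1 R2 => reval r R1 `|` reval r R2
  | RDiff _ R1 R2 => reval r R1 `\` reval r R2
  | RProd _ _ R1 R2 =>
      [set t | exists u v, [/\ reval r R1 u, reval r R2 v & t = [tuple of u ++ v]]]
  | RPow _ X => [set t | forall i, reval r X [tuple tnth t i]]
  | RProj _ i R => [set t | exists2 u, reval r R u & t = [tuple tnth u i]]
  | RField _ R => [set t | exists u i, reval r R u /\ t = [tuple tnth u i]]
  end.

Fixpoint sat (T : Type) (M : henkin T) (e : ienv T) (r : renv T) (p : formula) :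
    Prop :=
  match p with
  | FEq x y => e x = e y
  | FLe x y => le M (e x) (e y)
  | FApp _ R xs => reval r R (map_tuple e xs)
  | FEqR _ R1 R2 => reval r R1 = reval r R2
  | FSub _ R1 R2 => reval r R1 `<=` reval r R2
  | FNot p => ~ sat M e r p
  | FAnd p q => sat M e r p /\ sat M e r q
  | FOr p q => sat M e r p \/ sat M e r q
  | FImp p q => sat M e r p -> sat M e r q
  | FAll1 x p => forall a, dom M a -> sat M (upd1 e x a) r p
  | FEx1 x p => exists a, dom M a /\ sat M (upd1 e x a) r p
  | FAll2 n k p => forall R, rels M n R -> sat M e (upd2 r k R) p
  | FEx2 n k p => exists R, rels M n R /\ sat M e (upd2 r k R) p
  end.

Definition env_in (T : Type) (M : henkin T) (e : ienv T) (r : renv T) : Prop :=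
  (forall x, dom M (e x)) /\ (forall n k, rels M n (r n k)).

(* Free variables are read universally. *)
Definition valid (T : Type) (M : henkin T) (p : formula) : Prop :=
  forall e r, env_in M e r -> sat M e r p.

Definition theory := set formula.

Definition models (T : Type) (M : henkin T) (Th : theory) : Prop :=
  forall p, Th p -> valid M p.

(* Provability, as truth in all Henkin models of the theory. *)
Definition proves (Th : theory) (p : formula) : Prop :=
  forall (T : Type) (M : henkin T), models M Th -> valid M p.

(* A strict upper bound on the indices of the relation variables of R; used to
   pick bound variables that capture nothing.                                 *)
Fixpoint rbound (n : nat) (R : rterm n) : nat :=
  match R with
  | RVar _ k => k.+1
  | REmpty _ => 0
  | RInter _ R1 R2 | RUnion _ R1 R2 | RDiff _ R1 R2 => maxn (rbound R1) (rbound R2)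
  | RProd _ _ R1 R2 => maxn (rbound R1) (rbound R2)
  | RPow _ X => rbound X
  | RProj _ _ R => rbound R
  | RField _ R => rbound R
  end.

Definition is_fun (f : rterm 2) (X Y : rterm 1) : formula :=
  FAnd (FSub f (RProd X Y))
    (FAnd (FAll1 0 (FImp (FApp1 X 0) (FEx1 1 (FApp2 f 0 1))))
          (FAll1 0 (FAll1 1 (FAll1 2
             (FImp (FAnd (FApp2 f 0 1) (FApp2 f 0 2)) (FEq 1 2)))))).

Definition is_inj (f : rterm 2) : formula :=
  FAll1 0 (FAll1 1 (FAll1 2
    (FImp (FAnd (FApp2 f 0 2) (FApp2 f 1 2)) (FEq 0 1)))).

Definition is_onto (f : rterm 2) (Y : rterm 1) : formula :=
  FAll1 0 (FImp (FApp1 Y 0) (FEx1 1 (FApp2 f 1 0))).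

Definition card_le (X Y : rterm 1) : formula :=
  let k := maxn (rbound X) (rbound Y) in
  FEx2 1 k (FAnd (is_fun (RVar 1 k) X Y) (is_inj (RVar 1 k))).

Definition card_lt (X Y : rterm 1) : formula :=
  FAnd (card_le X Y) (FNot (card_le Y X)).

Definition dedekind_infinite (X : rterm 1) : formula :=
  let k := rbound X in
  FEx2 1 k (FAnd (is_fun (RVar 1 k) X X)
             (FAnd (is_inj (RVar 1 k)) (FNot (is_onto (RVar 1 k) X)))).

Definition dedekind_finite (X : rterm 1) : formula :=
  FNot (dedekind_infinite X).

Definition ax_ext (n : nat) : formula :=
  FAll2 n 0 (FAll2 n 1
    (FImp (all1s (iota 0 n.+1)
             (FIff (FApp (RVar n 0) [tuple of iota 0 n.+1])
                   (FApp (RVar n 1) [tuple of iota 0 n.+1])))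
          (FEqR (RVar n 0) (RVar n 1)))).

Definition ax_comp (n k : nat) (xs : n.+1.-tuple nat) (p : formula) : formula :=
  FEx2 n k (all1s xs (FIff (FApp (RVar n k) xs) p)).

Definition ax_refl : formula := FAll1 0 (FLe 0 0).

Definition ax_antisym : formula :=
  FAll1 0 (FAll1 1 (FImp (FAnd (FLe 0 1) (FLe 1 0)) (FEq 0 1))).

Definition ax_trans : formula :=
  FAll1 0 (FAll1 1 (FAll1 2 (FImp (FAnd (FLe 0 1) (FLe 1 2)) (FLe 0 2)))).

Definition ax_linear : formula :=
  FAll1 0 (FAll1 1 (FOr (FLe 0 1) (FLe 1 0))).

Definition ax_least : formula :=
  FAll2 0 0 (FImp (FEx1 0 (FApp1 (RVar 0 0) 0))
    (FEx1 0 (FAnd (FApp1 (RVar 0 0) 0)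
                  (FAll1 1 (FImp (FApp1 (RVar 0 0) 1) (FLe 0 1)))))).

(* The universe is not a term: the axiom speaks of the unary relation that
   holds of all individuals.                                                  *)
Definition ax_fin : formula :=
  FAll2 0 0 (FImp (FAll1 0 (FIff (FApp1 (RVar 0 0) 0) (FEq 0 0)))
                  (dedekind_finite (RVar 0 0))).

Inductive sigma11_CA0_fin : theory :=
| CA_ext n : sigma11_CA0_fin (ax_ext n)
| CA_comp n k (xs : n.+1.-tuple nat) p of
    sigma11 p & uniq xs & ~~ free2 n k p : sigma11_CA0_fin (ax_comp k xs p)
| CA_refl : sigma11_CA0_fin ax_refl
| CA_antisym : sigma11_CA0_fin ax_antisym
| CA_trans : sigma11_CA0_fin ax_trans
| CA_linear : sigma11_CA0_fin ax_linear
| CA_least : sigma11_CA0_fin ax_least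
| CA_fin : sigma11_CA0_fin ax_fin.

(* A quantifier with unary arguments split as R_1..R_a and R'_1..R'_b: the
   formula Q(R, R') for all unary terms R, R'.                                *)
Definition gquantifier (a b : nat) :=
  a.-tuple (rterm 1) -> b.-tuple (rterm 1) -> formula.

Definition Most : gquantifier 1 1 := fun R R' =>
  let F := tnth R ord0 in let G := tnth R' ord0 in
  card_lt (RDiff F G) (RInter F G).

Definition More_than : gquantifier 2 1 := fun R R' =>
  let F := tnth R ord0 in let G := tnth R (lift ord0 ord0) in
  let H := tnth R' ord0 in
  card_lt (RInter G H) (RInter F H).

Section Notions.
Variables (a b : nat).

Definition vars : a.-tuple (rterm 1) := [tuple RVar 0 i | i < a].
Definition vars' : b.-tuple (rterm 1) := [tuple RVar 0 (a + i) | i < b].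

Definition all_vars (p : formula) : formula :=
  foldr (FAll2 0) p (iota 0 (a + b)).

Definition ufield : rterm 1 :=
  foldr (fun R U => RUnion (RField R) U) (REmpty 0) vars.

(* The last conjunct keeps the bounding term from being captured; it can always
   be met by renaming bound variables.                                        *)
Definition displayed (p : formula) : Prop :=
  [/\ forall x, ~~ free1 x p,
      forall n k, free2 n k p -> n = 0 /\ k < a + b
    & forall n k, rocc n k ufield -> ~~ binds2 n k p].

Definition bounded_delta11 (Th : theory) (Q : gquantifier a b) : Prop :=
  exists Phi Psi : formula,
  [/\ sigma11 Phi, pi11 Psi, displayed Phi & displayed Psi] /\
  proves Th (all_vars (FIff (Q vars vars') (bound ufield Phi))) /\
  proves Th (all_vars (FIff (Q vars vars') (bound ufield Psi))).

Definition henkin_domain_independent (Th : theory) (Q : gquantifier a b) :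
    Prop :=
  forall (T : Type) (A B : henkin T),
  models A Th -> models B Th -> substructure A B ->
  forall e r, env_in A e r ->
  (sat A e r (Q vars vars') <-> sat B e r (Q vars vars')).

Definition henkin_conservative (Th : theory) (Q : gquantifier a b) : Prop :=
  proves Th (all_vars (FIff (Q vars vars')
                            (Q vars (map_tuple (RInter ufield) vars')))).

End Notions.

(* Main.v *)
(* Everything rests on two facts about a Henkin model of the theory.
   (a) Any two unary relations X, Y of the model are comparable.  The points x
   such that some internal partial injection from X to Y covers X up to x or
   exhausts Y form a set by a single use of Sigma^1_1 comprehension.  A least
   missing point x0 cannot exist: the set of its strict predecessors has a
   maximum by Dedekind finiteness, so a partial injection covers X strictly
   below x0, and it extends by one pair.
   (b) An injection X -> Y that is not onto excludes any injection Y -> X,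
   again by Dedekind finiteness.
   Hence |X| < |Y| holds iff there is a non-surjective injection X -> Y, which
   is Sigma^1_1, iff there is no injection Y -> X, which is Pi^1_1; both only
   speak of subsets of (X U Y)^2.  A witness of the first form, or a
   counterexample to the second, remains one in any larger model, whence domain
   independence. *)
From mathcomp Require Import all_boot.
From mathcomp Require Import boolp classical_sets.
From Stdlib Require Import Setoid.
Require Import Defs.

Set Implicit Arguments.
Unset Strict Implicit.
Unset Printing Implicit Defensive.

Local Open Scope classical_set_scope.

(** * Relations as predicates, and values of terms *)

Definition app1 (T : Type) (X : set (1.-tuple T)) (a : T) : Prop := X [tuple a].

Definition app2 (T : Type) (f : set (2.-tuple T)) (a b : T) : Prop :=
  f [tuple a; b].

Lemma tuple1E (T : Type) (t : 1.-tuple T) : t = [tuple tnth t ord0].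
Proof. by apply: eq_from_tnth => i; rewrite (ord1 i). Qed.

Lemma tuple2E (T : Type) (t : 2.-tuple T) :
  t = [tuple tnth t ord0; tnth t (lift ord0 ord0)].
Proof.
case: t => -[|a [|b [|c s]]] // p; apply: val_inj => /=.
by rewrite !(tnth_nth a).
Qed.

Lemma sat_FApp1 (T : Type) (M : henkin T) e r (X : rterm 1) x :
  sat M e r (FApp1 X x) <-> app1 (reval r X) (e x).
Proof.
rewrite /FApp1 /app1 /=.
by have -> : map_tuple e [tuple x] = [tuple e x] by apply: val_inj.
Qed.

Lemma sat_FApp2 (T : Type) (M : henkin T) e r (f : rterm 2) x y :
  sat M e r (FApp2 f x y) <-> app2 (reval r f) (e x) (e y).
Proof.
rewrite /FApp2 /app2 /=.
by have -> : map_tuple e [tuple x; y] = [tuple e x; e y] by apply: val_inj.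
Qed.

Lemma app2_RProd (T : Type) (r : renv T) (X Y : rterm 1) a b :
  app2 (reval r (RProd X Y)) a b <-> app1 (reval r X) a /\ app1 (reval r Y) b.
Proof.
split=> [[u [v [Xu Yv]]]|[Xa Yb]]; last first.
  by exists [tuple a], [tuple b]; split=> //; apply: val_inj.
rewrite (tuple1E u) (tuple1E v) in Xu Yv *.
by move/(congr1 val) => -[-> ->].
Qed.

Lemma reval_RField (T : Type) (r : renv T) (X : rterm 1) :
  reval r (RField X) = reval r X.
Proof.
apply/seteqP; split=> t /=.
  by move=> [u [i [Xu ->]]]; rewrite (ord1 i) -tuple1E.
by move=> Xt; exists t, ord0; rewrite -tuple1E.
Qed.

(** * Updated interpretations and fresh relation variables *)

Lemma upd2_same (T : Type) (r : renv T) n k (R : set (n.+1.-tuple T)) j :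
  upd2 r k R n j = if j == k then R else r n j.
Proof. by rewrite /upd2 dfwith_in. Qed.

Lemma upd2_other (T : Type) (r : renv T) n k (R : set (n.+1.-tuple T)) m j :
  (m, j) != (n, k) -> upd2 r k R m j = r m j.
Proof.
case: (eqVneq n m) => [E|nm _]; last by rewrite /upd2 dfwith_out.
by case: m / E; rewrite upd2_same xpair_eqE eqxx /= => /negPf ->.
Qed.

Lemma reval_eq (T : Type) (r r' : renv T) m (t : rterm m) :
  (forall n k, rocc n k t -> r n k = r' n k) -> reval r t = reval r' t.
Proof.
elim: t => //=.
- by move=> n k; apply; rewrite !eqxx.
- by move=> n t1 IH1 t2 IH2 H; rewrite IH1 ?IH2 //
    => ? ? h; apply: H; rewrite h ?orbT.
- by move=> n t1 IH1 t2 IH2 H; rewrite IH1 ?IH2 //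
    => ? ? h; apply: H; rewrite h ?orbT.
- by move=> n t1 IH1 t2 IH2 H; rewrite IH1 ?IH2 //
    => ? ? h; apply: H; rewrite h ?orbT.
- by move=> n n' t1 IH1 t2 IH2 H; rewrite IH1 ?IH2 //
    => ? ? h; apply: H; rewrite h ?orbT.
- by move=> n t IH H; rewrite IH.
- by move=> n i t IH H; rewrite IH.
- by move=> n t IH H; rewrite IH.
Qed.

Lemma rocc_rbound n k m (t : rterm m) : rbound t <= k -> ~~ rocc n k t.
Proof.
elim: t => //=.
- by move=> n' k' h; rewrite negb_and (gtn_eqF h) orbT.
- by move=> n' t1 IH1 t2 IH2; rewrite negb_or geq_max => /andP[/IH1 -> /IH2 ->].
- by move=> n' t1 IH1 t2 IH2; rewrite negb_or geq_max => /andP[/IH1 -> /IH2 ->].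
- by move=> n' t1 IH1 t2 IH2; rewrite negb_or geq_max => /andP[/IH1 -> /IH2 ->].
- by move=> m' n' t1 IH1 t2 IH2; rewrite negb_or geq_max => /andP[/IH1 -> /IH2 ->].
Qed.

Lemma reval_upd2 (T : Type) (r : renv T) n k (R : set (n.+1.-tuple T)) m
    (t : rterm m) : ~~ rocc n k t -> reval (upd2 r k R) t = reval r t.
Proof.
move=> Nt; apply: reval_eq => n' k' t_n'k'; apply: upd2_other.
by apply: contraTneq t_n'k' => -[-> ->].
Qed.

Lemma sat_eq (T : Type) (M : henkin T) p e (r r' : renv T) :
  (forall n k, free2 n k p -> r n k = r' n k) -> sat M e r p <-> sat M e r' p.
Proof.
elim: p e r r' => //=.
- by move=> n R xs e r r' H; rewrite (reval_eq H).
- by move=> n R S e r r' H; rewrite (@reval_eq _ r r' _ R) ?(@reval_eq _ r r' _ S) // => ? ? h;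
    apply: H; rewrite h ?orbT.
- by move=> n R S e r r' H; rewrite (@reval_eq _ r r' _ R) ?(@reval_eq _ r r' _ S) // => ? ? h;
    apply: H; rewrite h ?orbT.
- by move=> p IH e r r' H; rewrite (IH e r r').
- by move=> p IHp q IHq e r r' H; rewrite (IHp e r r') ?(IHq e r r') // => ? ? h;
    apply: H; rewrite h ?orbT.
- by move=> p IHp q IHq e r r' H; rewrite (IHp e r r') ?(IHq e r r') // => ? ? h;
    apply: H; rewrite h ?orbT.
- by move=> p IHp q IHq e r r' H; rewrite (IHp e r r') ?(IHq e r r') // => ? ? h;
    apply: H; rewrite h ?orbT.
- by move=> x p IH e r r' H; split=> Hp a Da;
    [rewrite -(IH _ r r')|rewrite (IH _ r r')] => //; apply: Hp.
- by move=> x p IH e r r' H; split=> -[a [Da Hp]]; exists a; split=> //;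
    [rewrite -(IH _ r r')|rewrite (IH _ r r')].
- move=> n k p IH e r r' H.
  have E (R : set (n.+1.-tuple T)) :
      sat M e (upd2 r k R) p <-> sat M e (upd2 r' k R) p.
    apply: IH => n' k' h; case: (eqVneq (n', k') (n, k)) => [[-> ->]|N].
      by rewrite !upd2_same eqxx.
    by rewrite !upd2_other // H // N.
  by split=> Hp R MR; apply/E; apply: Hp.
- move=> n k p IH e r r' H.
  have E (R : set (n.+1.-tuple T)) :
      sat M e (upd2 r k R) p <-> sat M e (upd2 r' k R) p.
    apply: IH => n' k' h; case: (eqVneq (n', k') (n, k)) => [[-> ->]|N].
      by rewrite !upd2_same eqxx.
    by rewrite !upd2_other // H // N.
  by split=> -[R [MR Hp]]; exists R; split=> //; apply/E.
Qed.

Lemma sat_upd2 (T : Type) (M : henkin T) p e (r : renv T) n k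
    (R : set (n.+1.-tuple T)) :
  ~~ free2 n k p -> sat M e (upd2 r k R) p <-> sat M e r p.
Proof.
move=> Np; apply: sat_eq => n' k' p_n'k'; apply: upd2_other.
by apply: contraTneq p_n'k' => -[-> ->].
Qed.

(** * Injections, and satisfaction of the cardinality formulas *)

Definition injection (T : Type) (f : set (2.-tuple T)) (X Y : set (1.-tuple T)) :
    Prop :=
  [/\ forall a b, app2 f a b -> app1 X a /\ app1 Y b,
      forall a, app1 X a -> exists b, app2 f a b,
      forall a b c, app2 f a b -> app2 f a c -> b = c
    & forall a b c, app2 f a c -> app2 f b c -> a = b].

Definition onto (T : Type) (f : set (2.-tuple T)) (Y : set (1.-tuple T)) : Prop :=
  forall b, app1 Y b -> exists a, app2 f a b.

(** This stores the parameters of comprehension instances: the relations in the lists interpret the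
    unary and binary variables of indices 0, 1 and so on, and [r] supplies the default values beyond
    the lists. *)
Definition renv_of (T : Type) (r : renv T) (Xs : seq (set (1.-tuple T)))
    (fs : seq (set (2.-tuple T))) : renv T :=
  fun n => match n with
           | 0 => fun k => nth (r 0 k) Xs k
           | 1 => fun k => nth (r 1 k) fs k
           | n'.+2 => r n'.+2
           end.

Section Model.
Variables (T : Type) (M : henkin T).

Lemma env_in_upd1 e r x a :
  env_in M e r -> dom M a -> env_in M (upd1 e x a) r.
Proof. by case=> He Hr Da; split=> // y; rewrite /upd1; case: eqP. Qed.

Lemma env_in_renv_of e r Xs fs :
  env_in M e r -> foldr (fun X => and (rels M 0 X)) True Xs ->
  foldr (fun f => and (rels M 1 f)) True fs -> env_in M e (renv_of r Xs fs).
Proof.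
case=> He Hr HX Hf; split=> // -[|[|n]] k //=.
- elim: Xs k HX (r 0 k) (Hr 0 k) => [|X Xs IH] [|k] //= [] // _ HX.
  exact: IH.
- elim: fs k Hf (r 1 k) (Hr 1 k) => [|f fs IH] [|k] //= [] // _ Hf.
  exact: IH.
Qed.

Lemma ex_env_in : exists e r, env_in M e r.
Proof.
have [a Da] := dom_neq0 M.
exists (fun=> a), (fun n _ => sval (cid (rels_neq0 M n))); split=> // n k.
by case: cid.
Qed.

Lemma app1_dom X a : rels M 0 X -> app1 X a -> dom M a.
Proof. by move=> MX /(rels_sub MX) /(_ ord0). Qed.

Lemma app2_dom f a b : rels M 1 f -> app2 f a b -> dom M a /\ dom M b.
Proof.
move=> Mf /(rels_sub Mf) D; split; first exact: (D ord0).
exact: (D (lift ord0 ord0)).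
Qed.

(** The quantifiers of the formula range over [dom M] only. Points related by [f] lie there because
    [f] belongs to the model, and the premise on [X] places the arguments there. *)
Lemma sat_is_fun_inj e r (f : rterm 2) (X Y : rterm 1) :
  rels M 1 (reval r f) -> (forall a, app1 (reval r X) a -> dom M a) ->
  sat M e r (FAnd (is_fun f X Y) (is_inj f)) <->
  injection (reval r f) (reval r X) (reval r Y).
Proof.
move=> Mf DX.
rewrite /is_fun /is_inj; cbn -[FApp1 FApp2 reval].
setoid_rewrite sat_FApp1; setoid_rewrite sat_FApp2; rewrite /upd1 /=.
split=> [[[H1 [H2 H3]] H4]|[H1 H2 H3 H4]].
  split.
  - by move=> a b /H1 /app2_RProd.
  - by move=> a Xa; have [b [_ fb]] := H2 a (DX _ Xa) Xa; exists b.
  - move=> a b c fab fac; have [Da Db] := app2_dom Mf fab.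
    by have [_ Dc] := app2_dom Mf fac; apply: (H3 a Da b Db c Dc).
  - move=> a b c fac fbc; have [Da Dc] := app2_dom Mf fac.
    by have [Db _] := app2_dom Mf fbc; apply: (H4 a Da b Db c Dc).
split; last by move=> a _ b _ c _ [? ?]; apply: H4; eauto.
split; first by move=> t; rewrite (tuple2E t) => /H1 /app2_RProd.
split; last by move=> a _ b _ c _ [? ?]; apply: H3; eauto.
move=> a _ /H2 [b fab]; exists b; split=> //.
by have [] := app2_dom Mf fab.
Qed.

Lemma sat_is_onto e r (f : rterm 2) (Y : rterm 1) :
  rels M 1 (reval r f) -> (forall a, app1 (reval r Y) a -> dom M a) ->
  sat M e r (is_onto f Y) <-> onto (reval r f) (reval r Y).
Proof.
move=> Mf DY; rewrite /is_onto; cbn -[FApp1 FApp2 reval].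
setoid_rewrite sat_FApp1; setoid_rewrite sat_FApp2; rewrite /upd1 /=.
split=> H a.
  by move=> Ya; have [b [_ ?]] := H a (DY _ Ya) Ya; exists b.
move=> _ /H [b fba]; exists b; split=> //.
by have [] := app2_dom Mf fba.
Qed.

Lemma sat_card_le e r (X Y : rterm 1) :
  (forall a, app1 (reval r X) a -> dom M a) ->
  sat M e r (card_le X Y) <->
  exists2 f, rels M 1 f & injection f (reval r X) (reval r Y).
Proof.
(* The index [k] exceeds every index occurring in [X] and [Y], so updating it changes the value of
   neither term. *)
move=> DX; rewrite /card_le; set k := maxn _ _.
have EX R : reval (upd2 r k (R : set (2.-tuple T))) X = reval r X.
  by apply/reval_upd2/rocc_rbound/leq_maxl.
have EY R : reval (upd2 r k (R : set (2.-tuple T))) Y = reval r Y.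
  by apply/reval_upd2/rocc_rbound/leq_maxr.
have E R : rels M 1 R ->
    sat M e (upd2 r k R) (FAnd (is_fun (RVar 1 k) X Y) (is_inj (RVar 1 k))) <->
    injection R (reval r X) (reval r Y).
  move=> MR.
  by rewrite sat_is_fun_inj ?EX ?EY //= upd2_same eqxx.
split; first by move=> [R [MR /(E R MR)]]; exists R.
by move=> [R MR IR]; exists R; split=> //; apply/E.
Qed.

(** * Consequences of comprehension, well-ordering and Dedekind finiteness *)

Hypothesis CA : models M sigma11_CA0_fin.

(* The index 9 is an arbitrary choice of a relation variable fresh for [p]. *)
Lemma comprehension1 p e r : env_in M e r -> sigma11 p -> ~~ free2 0 9 p ->
  exists2 S, rels M 0 S &
    forall a, dom M a -> (app1 S a <-> sat M (upd1 e 0 a) r p).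
Proof.
move=> Her p_s p_f.
have [S [MS HS]] :=
  CA (CA_comp (n := 0) (k := 9) (xs := [tuple 0]) p_s isT p_f) Her.
exists S => // a Da; have [H1 H2] := HS a Da.
have := sat_FApp1 M (upd1 e 0 a) (upd2 r 9 S) (RVar 0 9) 0.
rewrite -(sat_upd2 M _ _ S p_f) [reval _ _]/= upd2_same => <-.
by split; [exact: H1|exact: H2].
Qed.

Lemma comprehension2 p e r : env_in M e r -> sigma11 p -> ~~ free2 1 9 p ->
  exists2 S, rels M 1 S &
    forall a b, dom M a -> dom M b ->
      (app2 S a b <-> sat M (upd1 (upd1 e 0 a) 1 b) r p).
Proof.
move=> Her p_s p_f.
have [S [MS HS]] :=
  CA (CA_comp (n := 1) (k := 9) (xs := [tuple 0; 1]) p_s isT p_f) Her.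
exists S => // a b Da Db; have [H1 H2] := HS a Da b Db.
have := sat_FApp2 M (upd1 (upd1 e 0 a) 1 b) (upd2 r 9 S) (RVar 1 9) 0 1.
rewrite -(sat_upd2 M _ _ S p_f) [reval _ _]/= upd2_same => <-.
by split; [exact: H1|exact: H2].
Qed.

Lemma le_anti a b : dom M a -> dom M b -> le M a b -> le M b a -> a = b.
Proof.
move=> Da Db ab ba; have [e [r Her]] := ex_env_in.
by have /= := CA CA_antisym Her a Da b Db; exact.
Qed.

Lemma has_least S a : rels M 0 S -> app1 S a ->
  exists2 b, app1 S b & forall c, app1 S c -> le M b c.
Proof.
move=> MS Sa; have [e [r Her]] := ex_env_in.
have := CA CA_least Her S MS; cbn -[FApp1 reval].
setoid_rewrite sat_FApp1; rewrite /= upd2_same /upd1 /= => -[].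
  by exists a; split=> //; apply: app1_dom Sa.
move=> b [Db [Sb Hb]]; exists b => // c Sc.
by apply: Hb => //; apply: app1_dom Sc.
Qed.

(** Comprehension for $x=x$ supplies the universe, which is not a term, as a unary relation of the
    model. *)
Lemma ex_univ : exists2 V, rels M 0 V & forall a, app1 V a <-> dom M a.
Proof.
have [e [r Her]] := ex_env_in.
have [V MV HV] := @comprehension1 (FEq 0 0) e r Her isT isT.
exists V => // a; split; first exact: app1_dom.
by move=> Da; apply/HV.
Qed.

(** The form in which [ax_fin] is used: a point omitted by [f] would make [f] a witness that the
    relation [V] of all individuals is Dedekind infinite. *)
Lemma univ_finite f :
  rels M 1 f -> (forall a, dom M a -> exists b, app2 f a b) ->
  (forall a b c, app2 f a b -> app2 f a c -> b = c) ->
  (forall a b c, app2 f a c -> app2 f b c -> a = b) ->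
  forall b, dom M b -> exists a, app2 f a b.
Proof.
move=> Mf f_tot f_fun f_inj b Db; have [e [r Her]] := ex_env_in.
have [V MV HV] := ex_univ.
have := CA CA_fin Her V MV; set r' := upd2 r 0 V => H.
have /= {}H := H _; apply: contrapT => Nb; apply: H.
  move=> a Da; have := sat_FApp1 M (upd1 e 0 a) r' (RVar 0 0) 0.
  by rewrite /= {2}/r' upd2_same /= HV => ->.
exists f; split=> //.
have Er1 : upd2 r' 1 f 1 1 = f by rewrite upd2_same.
have Er0 : upd2 r' 1 f 0 0 = V by rewrite upd2_other // /r' upd2_same.
have : sat M e (upd2 r' 1 f)
         (FAnd (is_fun (RVar 1 1) (RVar 0 0) (RVar 0 0)) (is_inj (RVar 1 1))).
  rewrite sat_is_fun_inj /= ?Er1 ?Er0 //; last by move=> a /HV.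
  split=> //; last by move=> a /HV /f_tot.
  by move=> x y /(app2_dom Mf) [Dx Dy]; split; apply/HV.
move=> [H1 H2]; split=> //; split=> //.
change (~ sat M e (upd2 r' 1 f) (is_onto (RVar 1 1) (RVar 0 0))).
rewrite sat_is_onto /= ?Er1 ?Er0 //; last by move=> a /HV.
by move=> H; apply: Nb; apply: H; apply/HV.
Qed.

(* Otherwise the successor function of [S], extended by the identity outside
   [S], would be an injection of the universe missing the least element of
   [S]. *)
Lemma has_max S a : rels M 0 S -> app1 S a ->
  exists2 b, app1 S b & forall c, app1 S c -> le M c b.
Proof.
move=> MS Sa; apply: contrapT => Nmax.
have no_max b : app1 S b -> exists2 c, app1 S c & ~ le M c b.
  move=> Sb; apply: contrapT => Nc; apply: Nmax; exists b => // c Sc.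
  by apply: contrapT => Ncb; apply: Nc; exists c.
have [e [r Her]] := ex_env_in.
have HS b : app1 S b -> dom M b by apply: app1_dom.
pose r' := renv_of r [:: S] [::].
have Her' : env_in M e r' by apply: env_in_renv_of.
pose S_ := RVar 0 0.
(* The successor of [a] is expressed as the least element of [S] that is not below [a]. *)
have [f Mf Hf] : exists2 f, rels M 1 f & forall a b, dom M a -> dom M b ->
    (app2 f a b <-> (~ app1 S a /\ a = b) \/
       (app1 S a /\ app1 S b /\ ~ le M b a /\
        forall c, dom M c -> app1 S c -> ~ le M c a -> le M b c)).
  have [//||f Mf Hf] := @comprehension2
    (FOr (FAnd (FNot (FApp1 S_ 0)) (FEq 0 1))
       (FAnd (FApp1 S_ 0) (FAnd (FApp1 S_ 1) (FAnd (FNot (FLe 1 0))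
          (FAll1 2 (FImp (FApp1 S_ 2) (FImp (FNot (FLe 2 0)) (FLe 1 2)))))))) e r' Her'.
    by [].
  exists f => // x y Dx Dy; rewrite (Hf x y Dx Dy); cbn -[FApp1 reval].
  by setoid_rewrite sat_FApp1.
have [m Sm m_least] := has_least MS Sa.
have fP x y : app2 f x y -> (~ app1 S x /\ x = y) \/
    [/\ app1 S x, app1 S y, ~ le M y x
      & forall c, app1 S c -> ~ le M c x -> le M y c].
  move=> fxy; have [Dx Dy] := app2_dom Mf fxy; move: fxy; rewrite Hf //.
  move=> [|[Sx [Sy [yx H]]]]; [by left|right; split=> // c Sc].
  by apply: H => //; apply: HS.
have [] := @univ_finite f Mf _ _ _ m (HS m Sm).
- move=> x Dx; case: (pselect (app1 S x)) => [Sx|NSx]; last first.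
    by exists x; apply/Hf => //; left.
  (* [L] consists of the elements of [S] that are not below [x]. It is non-empty because [S] has no
     maximum, and its least element is the required value. *)
  have [L ML HL] : exists2 L, rels M 0 L &
      forall c, dom M c -> (app1 L c <-> app1 S c /\ ~ le M c x).
    have [||L ML HL] := @comprehension1 (FAnd (FApp1 S_ 0) (FNot (FLe 0 1)))
      (upd1 e 1 x) r' (env_in_upd1 1 Her' Dx); [by []..|].
    exists L => // c Dc; rewrite (HL c Dc); cbn -[FApp1 reval].
    by rewrite sat_FApp1.
  have [c Sc cx] := no_max x Sx.
  have [|y Ly y_least] := has_least (a := c) ML.
    by apply/HL => //; apply: HS.
  have /HL [//|Sy yx] := Ly; first exact: app1_dom Ly.
  exists y; apply/Hf => //; first exact: HS.
  right; do 3!split=> //; move=> d Dd Sd dx; apply: y_least.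
  by apply/HL.
- move=> x y z /fP [[NSx xy]|[Sx Sy yx Hy]] /fP [[NSx' xz]|[Sx' Sz zx Hz]] //.
    by rewrite -xy -xz.
  by apply: le_anti; [apply: HS..|apply: Hy|apply: Hz].
- move=> x y z /fP [[NSx xz]|[Sx Sz zx Hz]] /fP [[NSy yz]|[Sy Sz' zy Hz']].
  + by rewrite xz yz.
  + by rewrite xz in NSx.
  + by rewrite yz in NSy.
  (* If $x$ were not below $y$, then the common successor $z$, being least among the elements of [S]
     not below $y$, would be below $x$. The other inequality is symmetric. *)
  + apply: le_anti; [exact: HS..| |]; apply: contrapT => N.
      by apply: zx; apply: Hz'.
    by apply: zy; apply: Hz.
- move=> x /fP [[NSx xm]|[Sx _ mx _]]; first by rewrite xm in NSx.
  by apply: mx; apply: m_least.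
Qed.

(** * Partial injections, comparability, and injections in both directions *)

(** Totality on [X] is left out so that such a relation can be enlarged one pair at a time. *)
Definition partial_injection (f : set (2.-tuple T)) (X Y : set (1.-tuple T)) :
    Prop :=
  [/\ forall a b, app2 f a b -> app1 X a /\ app1 Y b,
      forall a b c, app2 f a b -> app2 f a c -> b = c
    & forall a b c, app2 f a c -> app2 f b c -> a = b].

Lemma partial_injection_empty X Y :
  exists2 f, rels M 1 f & partial_injection f X Y.
Proof.
have [e [r Her]] := ex_env_in.
have [||f Mf Hf] := @comprehension2 (FNot (FEq 0 0)) e r Her; [by []..|].
have Nf a b : ~ app2 f a b.
  by move=> fab; have [Da Db] := app2_dom Mf fab; move/(Hf a b Da Db): fab; apply.
by exists f => //; split=> [a b|a b c|a b c] /Nf.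
Qed.

(** The new graph is $f\cup\{(x,y)\}$, first-order definable from [f] and from [x] and [y], the
    values of the individual variables 2 and 3. As [x] is a new argument and [y] a new value,
    functionality and injectivity persist. *)
Lemma partial_injection_add f X Y x y :
  rels M 1 f -> partial_injection f X Y ->
  dom M x -> app1 X x -> dom M y -> app1 Y y ->
  ~ (exists b, app2 f x b) -> ~ (exists a, app2 f a y) ->
  exists2 g, rels M 1 g &
    partial_injection g X Y /\
    forall a b, app2 g a b <-> app2 f a b \/ a = x /\ b = y.
Proof.
move=> Mf [f_sub f_fun f_inj] Dx Xx Dy Yy Nx Ny.
have [e [r Her]] := ex_env_in.
have [| | |g Mg Hg] := @comprehension2
  (FOr (FApp2 (RVar 1 0) 0 1) (FAnd (FEq 0 2) (FEq 1 3)))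
  (upd1 (upd1 e 2 x) 3 y) (renv_of r [::] [:: f]).
- by do 2!apply: env_in_upd1 => //; apply: env_in_renv_of.
- by [].
- by [].
have gP a b : app2 g a b <-> app2 f a b \/ a = x /\ b = y.
  have E : dom M a -> dom M b ->
      (app2 g a b <-> app2 f a b \/ a = x /\ b = y).
    move=> Da Db; rewrite (Hg a b Da Db); cbn -[FApp2 reval].
    by rewrite sat_FApp2.
  split=> [gab|H]; first by have [Da Db] := app2_dom Mg gab; apply/E.
  by apply/E => //; case: H => [/(app2_dom Mf) []|[? ?]]; subst.
exists g => //; split=> //; split.
- by move=> a b /gP [/f_sub|[-> ->]].
- move=> a b c /gP [fab|[-> ->]] /gP [fac|[ax ->]] //.
  + exact: f_fun fab fac.
  + by case: Nx; exists b; rewrite -ax.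
  + by case: Nx; exists c.
- move=> a b c /gP [fac|[-> ->]] /gP [fbc|[-> cy]] //.
  + exact: f_inj fac fbc.
  + by case: Ny; exists a; rewrite -cy.
  + by case: Ny; exists b.
Qed.

Lemma converse f : rels M 1 f ->
  exists2 g, rels M 1 g & forall a b, app2 g a b <-> app2 f b a.
Proof.
move=> Mf; have [e [r Her]] := ex_env_in.
have [||g Mg Hg] := @comprehension2 (FApp2 (RVar 1 0) 1 0)
  e (renv_of r [::] [:: f]) (@env_in_renv_of e r [::] [:: f] Her I (conj Mf I));
  [by []..|].
exists g => // a b.
have E : dom M a -> dom M b -> (app2 g a b <-> app2 f b a).
  by move=> Da Db; rewrite (Hg a b Da Db) sat_FApp2.
split=> [gab|fba]; first by have [Da Db] := app2_dom Mg gab; apply/E.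
by have [Db Da] := app2_dom Mf fba; apply/E.
Qed.

(** Passing to the converse graph exchanges functionality with injectivity and turns surjectivity
    onto [Y] into totality on [Y]. *)
Lemma partial_injection_converse X Y f :
  rels M 1 f -> partial_injection f X Y -> onto f Y ->
  exists2 g, rels M 1 g & injection g Y X.
Proof.
move=> Mf [f_sub f_fun f_inj] f_onto.
have [g Mg gP] := converse Mf; exists g => //; split.
- by move=> x y /gP /f_sub [].
- by move=> y /f_onto [x fxy]; exists x; apply/gP.
- by move=> x y z /gP ? /gP ?; apply: f_inj; eauto.
- by move=> x y z /gP ? /gP ?; apply: f_fun; eauto.
Qed.

Lemma set_compl S : rels M 0 S ->
  exists2 S', rels M 0 S' & forall a, dom M a -> (app1 S' a <-> ~ app1 S a).
Proof.
move=> MS; have [e [r Her]] := ex_env_in.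
have [||S' MS' HS'] := @comprehension1 (FNot (FApp1 (RVar 0 0) 0))
  e (renv_of r [:: S] [::]) (@env_in_renv_of e r [:: S] [::] Her (conj MS I) I);
  [by []..|].
exists S' => // a Da; rewrite (HS' a Da); cbn -[FApp1 reval].
by rewrite sat_FApp1.
Qed.

Lemma set_below x : dom M x ->
  exists2 L, rels M 0 L &
    forall a, dom M a -> (app1 L a <-> le M a x /\ a <> x).
Proof.
move=> Dx; have [e [r Her]] := ex_env_in.
have [||L ML HL] := @comprehension1 (FAnd (FLe 0 1) (FNot (FEq 0 1)))
  (upd1 e 1 x) r (env_in_upd1 1 Her Dx); [by []..|].
by exists L.
Qed.

(** The second alternative records that [Y] is used up, so that no further pair can be added; the
    converse then injects [Y] into [X]. *)
Definition covers_upto X Y x f : Prop :=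
  (forall z, dom M z -> le M z x -> app1 X z -> exists y, app2 f z y) \/
  onto f Y.

(** The condition is one existential quantifier over a binary relation in front of a first-order
    matrix, a genuinely $\Sigma^1_1$ instance of comprehension. *)
Lemma set_of_covered X Y : rels M 0 X -> rels M 0 Y ->
  exists2 S, rels M 0 S & forall x, dom M x ->
    (app1 S x <-> exists2 f, rels M 1 f &
       partial_injection f X Y /\ covers_upto X Y x f).
Proof.
move=> MX MY; have [e [r Her]] := ex_env_in.
set f := RVar 1 0; set X' := RVar 0 0; set Y' := RVar 0 1.
(* The individual variable 0 stands for [x] and is free only in [FLe 1 0]; its other occurrences are
   bound. *)
have [||S MS HS] := @comprehension1
  (FEx2 1 0 (FAnd (FAnd (FSub f (RProd X' Y'))
     (FAnd (FAll1 0 (FAll1 1 (FAll1 2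
              (FImp (FAnd (FApp2 f 0 1) (FApp2 f 0 2)) (FEq 1 2)))))
           (is_inj f)))
     (FOr (FAll1 1 (FImp (FLe 1 0) (FImp (FApp1 X' 1) (FEx1 2 (FApp2 f 1 2)))))
          (is_onto f Y'))))
  e (renv_of r [:: X; Y] [::]) (@env_in_renv_of e r [:: X; Y] [::] Her (conj MX (conj MY I)) I);
  [by []..|].
exists S => // x Dx; rewrite (HS x Dx) {HS}; cbn -[FApp1 FApp2 reval is_onto].
set r' := renv_of _ _ _.
have E R : rels M 1 R ->
  [/\ reval (upd2 r' 0 R) f = R, reval (upd2 r' 0 R) X' = X
    & reval (upd2 r' 0 R) Y' = Y].
  by split; rewrite /= ?upd2_same // upd2_other.
split=> [[R [MR]]|[R MR]]; have [ER EX EY] := E R MR.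
  rewrite sat_is_onto ?ER ?EY //; last by move=> a; apply: app1_dom.
  setoid_rewrite sat_FApp1; setoid_rewrite sat_FApp2; rewrite ER EX /upd1 /=.
  move=> [[H1 [H2 H3]] H4]; exists R => //; split; last first.
    case: H4 => [H4|H4]; [left|by right].
    by move=> z Dz zx Xz; have [y [_ ?]] := H4 z Dz zx Xz; exists y.
  split.
  - move=> a b Rab.
    have : app2 (reval (upd2 r' 0 R) (RProd X' Y')) a b by apply: H1.
    by rewrite app2_RProd EX EY.
  - move=> a b c Rab Rac; have [Da Db] := app2_dom MR Rab.
    by have [_ Dc] := app2_dom MR Rac; apply: (H2 a Da b Db c Dc).
  - move=> a b c Rac Rbc; have [Da Dc] := app2_dom MR Rac.
    by have [Db _] := app2_dom MR Rbc; apply: (H3 a Da b Db c Dc).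
move=> [[H1 H2 H3] H4]; exists R; split=> //.
rewrite sat_is_onto ?ER ?EY //; last by move=> a; apply: app1_dom.
setoid_rewrite sat_FApp1; setoid_rewrite sat_FApp2; rewrite ER EX /upd1 /=.
split.
  split.
    move=> t; rewrite (tuple2E t) => /H1; rewrite -EX -EY.
    by move/(app2_RProd _ X' Y').
  by split=> a _ b _ c _ [? ?]; [apply: H2|apply: H3]; eauto.
case: H4 => [H4|H4]; [left|by right].
move=> z Dz zx Xz; have [y Rzy] := H4 z Dz zx Xz; exists y; split=> //.
by have [] := app2_dom MR Rzy.
Qed.

(** Induction along the well-order through a least counterexample [x0]. Dedekind finiteness removes
    the limit case: a non-empty set of strict predecessors has a maximum. *)
Lemma all_covered X Y x : rels M 0 X -> rels M 0 Y -> dom M x ->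
  exists2 f, rels M 1 f & partial_injection f X Y /\ covers_upto X Y x f.
Proof.
move=> MX MY Dx; have [S MS HS] := set_of_covered MX MY.
have [S' MS' HS'] := set_compl MS.
apply/HS => //; apply: contrapT => /(HS' x Dx) S'x.
have [x0 S'x0 x0_least] := has_least MS' S'x.
have Dx0 := app1_dom MS' S'x0.
have below z : dom M z -> le M z x0 -> z <> x0 -> app1 S z.
  move=> Dz zx0 Nz; apply: contrapT => /(HS' z Dz) /x0_least x0z.
  by apply: Nz; apply: le_anti.
move/(HS' x0 Dx0): S'x0; apply; apply/HS => //.
(* This [f] settles everything strictly before [x0]: it is the empty relation if nothing precedes
   [x0], and otherwise a partial injection belonging to the greatest strict predecessor [m]. *)
have [f Mf [f_pinj Hf]] : exists2 f, rels M 1 f & partial_injection f X Y /\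
    ((forall z, dom M z -> le M z x0 -> z <> x0 -> app1 X z ->
        exists y, app2 f z y) \/ onto f Y).
  have [L ML HL] := set_below Dx0.
  case: (pselect (exists a, app1 L a)) => [[a La]|NL]; last first.
    have [f Mf f_pinj] := partial_injection_empty X Y.
    exists f => //; split=> //; left=> z Dz zx0 Nz.
    by case: NL; exists z; apply/HL.
  have [m Lm m_max] := has_max ML La.
  have Dm := app1_dom ML Lm; have /HL [//|mx0 Nm] := Lm.
  have /HS [//|f Mf [f_pinj Hf]] := below m Dm mx0 Nm.
  exists f => //; split=> //; case: Hf => [Hf|]; [left|by right].
  by move=> z Dz zx0 Nz; apply: Hf => //; apply: m_max; apply/HL.
case: Hf => [Hf|Hf]; last by exists f => //; split=> //; right.
case: (pselect (onto f Y)) => [f_onto|Nonto].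
  by exists f => //; split=> //; right.
case: (pselect (app1 X x0 /\ ~ exists b, app2 f x0 b)) => [[Xx0 Nx0]|H].
  have [y [Yy Ny]] : exists y, app1 Y y /\ ~ exists a, app2 f a y.
    apply: contrapT => H; apply: Nonto => y Yy; apply: contrapT => Ny.
    by apply: H; exists y.
  have [g Mg [g_pinj Hg]] :=
    partial_injection_add Mf f_pinj Dx0 Xx0 (app1_dom MY Yy) Yy Nx0 Ny.
  exists g => //; split=> //; left=> z Dz zx0 Xz.
  case: (pselect (z = x0)) => [->|Nz]; first by exists y; apply/Hg; right.
  by have [b fzb] := Hf z Dz zx0 Nz Xz; exists b; apply/Hg; left.
exists f => //; split=> //; left=> z Dz zx0 Xz.
case: (pselect (z = x0)) => [E|Nz]; last exact: Hf.
by apply: contrapT => N; apply: H; rewrite -E.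
Qed.

(** By finiteness the universe has a greatest element [m]. Covering [X] up to [m] is totality on
    [X]; exhausting [Y] gives an injection in the other direction. *)
Lemma comparability X Y : rels M 0 X -> rels M 0 Y ->
  (exists2 f, rels M 1 f & injection f X Y) \/
  (exists2 f, rels M 1 f & injection f Y X).
Proof.
move=> MX MY; have [V MV HV] := ex_univ.
have [a /HV Va] := dom_neq0 M.
have [m /HV Dm m_max] := has_max MV Va.
have [f Mf [f_pinj [f_tot|f_onto]]] := all_covered MX MY Dm.
  left; exists f => //; have [f_sub f_fun f_inj] := f_pinj.
  split=> // x Xx; have Dx := app1_dom MX Xx.
  by apply: f_tot => //; apply: m_max; apply/HV.
by right; apply: partial_injection_converse Mf f_pinj f_onto.
Qed.

(* [f \o g] on [Y], extended by the identity, would be a non-surjective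
   injection of the universe. *)
Lemma injection_not_onto X Y f g :
  rels M 0 Y -> rels M 1 f -> rels M 1 g ->
  injection f X Y -> injection g Y X -> onto f Y.
Proof.
move=> MY Mf Mg [f_sub f_tot f_fun f_inj] [g_sub g_tot g_fun g_inj] y0 Yy0.
have [e [r Her]] := ex_env_in.
have [||h Mh Hh] := @comprehension2
  (FOr (FAnd (FNot (FApp1 (RVar 0 0) 0)) (FEq 0 1))
       (FEx1 2 (FAnd (FApp2 (RVar 1 1) 0 2) (FApp2 (RVar 1 0) 2 1))))
  e (renv_of r [:: Y] [:: f; g])
  (@env_in_renv_of e r [:: Y] [:: f; g] Her (conj MY I) (conj Mf (conj Mg I)));
  [by []..|].
have {}Hh a b : dom M a -> dom M b -> app2 h a b <->
    (~ app1 Y a /\ a = b) \/ exists2 c, app2 g a c & app2 f c b.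
  move=> Da Db; rewrite (Hh a b Da Db) {Hh}; cbn -[FApp1 FApp2 reval].
  setoid_rewrite sat_FApp1; setoid_rewrite sat_FApp2; rewrite /upd1 /=.
  split=> [[|[c [_ [? ?]]]]|[|[c gac fcb]]]; try by left.
    by right; exists c.
  by right; exists c; split=> //; have [] := app2_dom Mg gac.
have hP a b : app2 h a b ->
    (~ app1 Y a /\ a = b) \/ exists2 c, app2 g a c & app2 f c b.
  by move=> hab; have [Da Db] := app2_dom Mh hab; apply/Hh.
apply: contrapT => Ny0.
(* The identity part reaches only points outside [Y], and the composite reaches only values of [f],
   so [h] omits [y0]. *)
have [] := @univ_finite h Mh _ _ _ y0 (app1_dom MY Yy0).
- move=> a Da; case: (pselect (app1 Y a)) => [Ya|NYa]; last first.
    by exists a; apply/Hh => //; left.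
  have [c gac] := g_tot a Ya; have [b fcb] := f_tot c (g_sub a c gac).2.
  by exists b; apply/Hh => //; [have [] := app2_dom Mf fcb|right; exists c].
- move=> a b c /hP [[NYa <-]|[x gax fxb]] /hP [[NYa' <-]|[x' gax' fxc]] //.
  + by case: (g_sub _ _ gax').
  + by case: (g_sub _ _ gax).
  + by move: fxb; rewrite (g_fun _ _ _ gax gax') => /f_fun; apply.
- move=> a b c /hP [[NYa Ea]|[x gax fxc]] /hP [[NYb Eb]|[x' gbx fxc']].
  + by rewrite Ea Eb.
  + by case: NYa; rewrite Ea; case: (f_sub _ _ fxc').
  + by case: NYb; rewrite Eb; case: (f_sub _ _ fxc).
  + by move: gax; rewrite (f_inj _ _ _ fxc fxc') => /g_inj; apply.
- by move=> a /hP [[NYa Ea]|[x _ fxy]]; [apply: NYa; rewrite Ea|apply: Ny0; exists x].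
Qed.

(** * Values of terms in the model, and two characterizations of $|X|<|Y|$ *)

(** Variables take values inside the domain and no constructor leaves it: there is a difference but
    no complement. *)
Lemma reval_dom e r m (R : rterm m) t i :
  env_in M e r -> reval r R t -> dom M (tnth t i).
Proof.
move=> [_ Hr]; elim: R t i => /=.
- by move=> n k t i /(rels_sub (Hr n k)).
- by [].
- by move=> n R IHR S _ t i [/IHR].
- by move=> n R IHR S IHS t i [/IHR|/IHS].
- by move=> n R IHR S _ t i [/IHR].
- move=> m1 n R IHR S IHS t i [u [v [Ru Sv ->]]].
  case: (split_ordP i) => j ->.
    by rewrite tnth_lshift; apply: IHR.
  by rewrite tnth_rshift; apply: IHS.
- by move=> n X IH t i /(_ i) /(IH _ ord0).
- by move=> n j R IH t i [u Ru ->]; rewrite (ord1 i); exact: (IH u j Ru).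
- by move=> n R IH t i [u [j [Ru ->]]]; rewrite (ord1 i); exact: (IH u j Ru).
Qed.

Lemma app1_reval_dom e r X a : env_in M e r -> app1 (reval r X) a -> dom M a.
Proof. by move=> Her /(reval_dom ord0 Her). Qed.

(** Comprehension for the atom [FApp1 X 0] gives a relation of the model with the same elements in
    the domain. Both sets lie in the domain, hence are equal. Index 9 is the fresh one of
    [comprehension1]. *)
Lemma rels_reval e r (X : rterm 1) :
  env_in M e r -> ~~ rocc 0 9 X -> rels M 0 (reval r X).
Proof.
move=> Her NX.
have [|S MS HS] := @comprehension1 (FApp1 X 0) e r Her isT; first by [].
suff -> : reval r X = S by [].
apply/seteqP; split=> t; rewrite (tuple1E t) => Ht.
  by apply/HS; [apply: app1_reval_dom Her Ht|apply/sat_FApp1].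
by have /HS := Ht; rewrite sat_FApp1; apply; apply: app1_dom Ht.
Qed.

(** An injection that is onto could be reversed, although no injection from [Y] to [X] exists.
    Conversely, an injection missing a point of [Y] excludes a backward one by
    [injection_not_onto]. *)
Lemma card_ltP X Y : rels M 0 X -> rels M 0 Y ->
  (exists2 f, rels M 1 f & injection f X Y) /\
    ~ (exists2 g, rels M 1 g & injection g Y X) <->
  exists2 f, rels M 1 f & injection f X Y /\ ~ onto f Y.
Proof.
move=> MX MY; split=> [[[f Mf f_inj] Ng]|[f Mf [f_inj Nf]]].
  exists f => //; split=> // f_onto; apply: Ng.
  have [f_sub _ f_fun f_inj'] := f_inj.
  exact: partial_injection_converse Mf (And3 f_sub f_fun f_inj') f_onto.
split; first by exists f.
by move=> [g Mg g_inj]; apply/Nf/(injection_not_onto MY Mf Mg f_inj g_inj).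
Qed.

(** Once there is no injection from [Y] to [X], comparability supplies one from [X] to [Y]. *)
Lemma card_lt_not_leP X Y : rels M 0 X -> rels M 0 Y ->
  (exists2 f, rels M 1 f & injection f X Y) /\
    ~ (exists2 g, rels M 1 g & injection g Y X) <->
  ~ (exists2 g, rels M 1 g & injection g Y X).
Proof. by move=> MX MY; split=> [[]//|N]; case: (comparability MX MY). Qed.

Lemma sat_card_lt e r (X Y : rterm 1) : env_in M e r ->
  sat M e r (card_lt X Y) <->
  (exists2 f, rels M 1 f & injection f (reval r X) (reval r Y)) /\
    ~ (exists2 g, rels M 1 g & injection g (reval r Y) (reval r X)).
Proof.
move=> Her; rewrite /card_lt; cbn -[card_le reval].
by rewrite !sat_card_le // => a; apply: app1_reval_dom Her.
Qed.

(** * Bounded $\Sigma^1_1$ and $\Pi^1_1$ forms of strict comparison *)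

(** Restricting the quantifiers to [U] changes nothing: arguments and values of a function from [X]
    to [Y] lie in [X] and [Y], hence in [U]. *)
Lemma sat_bound_is_fun_inj e r (U X Y : rterm 1) (f : rterm 2) :
  env_in M e r -> reval r X `<=` reval r U -> reval r Y `<=` reval r U ->
  sat M e r (bound U (FAnd (is_fun f X Y) (is_inj f))) <->
  injection (reval r f) (reval r X) (reval r Y).
Proof.
move=> Her XU YU; have DX a := @app1_reval_dom e r X a Her.
have DY a := @app1_reval_dom e r Y a Her.
rewrite /is_fun /is_inj; cbn -[FApp1 FApp2 reval].
have -> x : bound U (FApp1 X x) = FApp1 X x by [].
have -> x y : bound U (FApp2 f x y) = FApp2 f x y by [].
setoid_rewrite sat_FApp1; setoid_rewrite sat_FApp2; rewrite /upd1 /=.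
split=> [[[H1 [H2 H3]] H4]|[H1 H2 H3 H4]].
  have fP a b : app2 (reval r f) a b ->
      [/\ app1 (reval r X) a, dom M a, app1 (reval r U) a,
          app1 (reval r Y) b & dom M b /\ app1 (reval r U) b].
    move/H1/(app2_RProd _ X Y) => [Xa Yb].
    by split; [|apply: DX|apply: XU| |split; [apply: DY|apply: YU]].
  split.
  - by move=> a b /fP [].
  - by move=> a Xa; have [b [_ [_ fb]]] := H2 a (DX _ Xa) (XU _ Xa) Xa; exists b.
  - move=> a b c fab fac; have [Xa Da Ua _ [Db Ub]] := fP _ _ fab.
    by have [_ _ _ _ [Dc Uc]] := fP _ _ fac; apply: (H3 a Da Ua b Db Ub c Dc Uc).
  - move=> a b c fac fbc; have [_ Da Ua _ [Dc Uc]] := fP _ _ fac.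
    by have [_ Db Ub _ _] := fP _ _ fbc; apply: (H4 a Da Ua b Db Ub c Dc Uc).
split; last by move=> a _ _ b _ _ c _ _ [? ?]; apply: H4; eauto.
split; first by move=> t; rewrite (tuple2E t) => /H1 /(app2_RProd _ X Y).
split; last by move=> a _ _ b _ _ c _ _ [? ?]; apply: H3; eauto.
move=> a _ _ /H2 [b fab]; exists b; have [_ Yb] := H1 _ _ fab.
by split; [apply: DY|split=> //; apply: YU].
Qed.

(** A preimage under [f] lies in [X], because [f] is an injection from [X] to [Y], and hence lies in
    [U]. *)
Lemma sat_bound_is_onto e r (U X Y : rterm 1) (f : rterm 2) :
  env_in M e r -> reval r X `<=` reval r U -> reval r Y `<=` reval r U ->
  injection (reval r f) (reval r X) (reval r Y) ->
  sat M e r (bound U (is_onto f Y)) <-> onto (reval r f) (reval r Y).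
Proof.
move=> Her XU YU [f_sub _ _ _]; rewrite /is_onto; cbn -[FApp1 FApp2 reval].
have -> x : bound U (FApp1 Y x) = FApp1 Y x by [].
have -> x y : bound U (FApp2 f x y) = FApp2 f x y by [].
setoid_rewrite sat_FApp1; setoid_rewrite sat_FApp2; rewrite /upd1 /=.
split=> [H b Yb|H b _ _ /H [a fab]].
  have [a [_ [_ ?]]] := H b (app1_reval_dom Her Yb) (YU _ Yb) Yb.
  by exists a.
have [Xa _] := f_sub a b fab.
by exists a; split; [apply: app1_reval_dom Her Xa|split=> //; apply: XU].
Qed.

End Model.

Lemma env_in_upd2 (T : Type) (M : henkin T) e r n k (R : set (n.+1.-tuple T)) :
  env_in M e r -> rels M n R -> env_in M e (upd2 r k R).
Proof.
case=> He Hr MR; split=> // m j.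
case: (eqVneq (m, j) (n, k)) => [[-> ->]|N]; first by rewrite upd2_same eqxx.
by rewrite upd2_other.
Qed.

Lemma valid_all_vars (T : Type) (M : henkin T) a b p :
  valid M p -> valid M (all_vars a b p).
Proof.
rewrite /all_vars; elim: iota => //= k ks IH /IH H e r Her R MR.
by apply: H; apply: env_in_upd2.
Qed.

(** This formula and [card_lt_pi] express the right-hand sides of [card_ltP] and [card_lt_not_leP].
    Their bound variable is binary, so it cannot capture unary variables of [X] and [Y]. *)
Definition card_lt_sigma (X Y : rterm 1) : formula :=
  let f := RVar 1 0 in
  FEx2 1 0 (FAnd (FAnd (is_fun f X Y) (is_inj f)) (FNot (is_onto f Y))).

Definition card_lt_pi (X Y : rterm 1) : formula :=
  let f := RVar 1 0 in FAll2 1 0 (FNot (FAnd (is_fun f Y X) (is_inj f))).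

Section CardLt.
Variables (T : Type) (M : henkin T) (e : ienv T) (r : renv T).
Variables (U X Y : rterm 1).
Hypotheses (Her : env_in M e r).
Hypotheses (NU : ~~ rocc 1 0 U) (NX : ~~ rocc 1 0 X) (NY : ~~ rocc 1 0 Y).
Hypotheses (XU : forall r', reval (T := T) r' X `<=` reval r' U).
Hypotheses (YU : forall r', reval (T := T) r' Y `<=` reval r' U).

Let upd_f (f : set (2.-tuple T)) : reval (upd2 r 0 f) (RVar 1 0) = f.
Proof. by rewrite /= upd2_same. Qed.

Let upd_X (f : set (2.-tuple T)) : reval (upd2 r 0 f) X = reval r X.
Proof. exact: reval_upd2. Qed.

Let upd_Y (f : set (2.-tuple T)) : reval (upd2 r 0 f) Y = reval r Y.
Proof. exact: reval_upd2. Qed.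

(** An injection from [X'] to [Y'] is contained in $U^2$, so bounding the quantifier over [f] loses
    no injection. The inclusions are taken under every interpretation because they are applied after
    the update by [f]. *)
Let square_sub (f : set (2.-tuple T)) (X' Y' : rterm 1) :
  ~~ rocc 1 0 X' -> ~~ rocc 1 0 Y' ->
  (forall r', reval (T := T) r' X' `<=` reval r' U) ->
  (forall r', reval (T := T) r' Y' `<=` reval r' U) ->
  injection f (reval r X') (reval r Y') ->
  sat M e (upd2 r 0 f) (FSub (RVar 1 0) (RPow 1 U)).
Proof.
move=> NX' NY' XU' YU' [f_sub _ _ _] t.
rewrite (tuple2E t) /= upd2_same => /f_sub [Xa Yb] i.
rewrite reval_upd2 //.
by case: (unliftP ord0 i) => [j ->|->]; [rewrite (ord1 j); apply: YU'|apply: XU'].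
Qed.

Lemma sat_card_lt_sigma :
  sat M e r (bound U (card_lt_sigma X Y)) <->
  exists2 f, rels M 1 f &
    injection f (reval r X) (reval r Y) /\ ~ onto f (reval r Y).
Proof.
have E f : rels M 1 f ->
    sat M e (upd2 r 0 f)
      (bound U (FAnd (is_fun (RVar 1 0) X Y) (is_inj (RVar 1 0))))
    <-> injection f (reval r X) (reval r Y).
  move=> Mf; rewrite sat_bound_is_fun_inj //; last exact: env_in_upd2.
  by rewrite upd_f upd_X upd_Y.
have E' f : rels M 1 f -> injection f (reval r X) (reval r Y) ->
    sat M e (upd2 r 0 f) (bound U (is_onto (RVar 1 0) Y)) <-> onto f (reval r Y).
  move=> Mf f_inj; rewrite (@sat_bound_is_onto _ _ _ _ U X Y) //; last 2 first.
  - exact: env_in_upd2.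
  - by rewrite upd_f upd_X upd_Y.
  by rewrite upd_f upd_Y.
split=> [[f [Mf [_ [/(E f Mf) f_inj Nf]]]]|[f Mf [f_inj Nf]]]; exists f => //.
  by split=> // /(E' f Mf f_inj).
split=> //; split; first exact: square_sub f_inj.
by split; [apply/(E f Mf)|move/(E' f Mf f_inj)].
Qed.

Lemma sat_card_lt_pi :
  sat M e r (bound U (card_lt_pi X Y)) <->
  ~ exists2 f, rels M 1 f & injection f (reval r Y) (reval r X).
Proof.
have E f : rels M 1 f ->
    sat M e (upd2 r 0 f)
      (bound U (FAnd (is_fun (RVar 1 0) Y X) (is_inj (RVar 1 0))))
    <-> injection f (reval r Y) (reval r X).
  move=> Mf; rewrite sat_bound_is_fun_inj //; last exact: env_in_upd2.
  by rewrite upd_f upd_X upd_Y.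
have -> : sat M e r (bound U (card_lt_pi X Y)) =
    forall f, rels M 1 f ->
      sat M e (upd2 r 0 f) (FSub (RVar 1 0) (RPow 1 U)) ->
      ~ sat M e (upd2 r 0 f)
          (bound U (FAnd (is_fun (RVar 1 0) Y X) (is_inj (RVar 1 0)))) by [].
split=> [H [f Mf f_inj]|N f Mf _ /(E f Mf) f_inj]; last by apply: N; exists f.
by apply: (H f Mf); [apply: square_sub f_inj|apply/(E f Mf)].
Qed.

End CardLt.

Section Quantifier.

(** * Quantifiers of the form $|X|<|Y|$ *)

Variables (a b : nat) (Q : gquantifier a b) (X Y : rterm 1).
Hypothesis QE : Q (vars a) (vars' a b) = card_lt X Y.
Hypotheses (NX : ~~ rocc 0 9 X) (NY : ~~ rocc 0 9 Y).

Lemma bounded_delta11_card_lt :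
  displayed a b (card_lt_sigma X Y) -> displayed a b (card_lt_pi X Y) ->
  ~~ rocc 1 0 (ufield a) -> ~~ rocc 1 0 X -> ~~ rocc 1 0 Y ->
  (forall (T : Type) (r : renv T), reval r X `<=` reval r (ufield a)) ->
  (forall (T : Type) (r : renv T), reval r Y `<=` reval r (ufield a)) ->
  bounded_delta11 sigma11_CA0_fin Q.
Proof.
move=> dS dP NU NX' NY' XU YU.
exists (card_lt_sigma X Y), (card_lt_pi X Y); split=> //.
split=> T M CA; apply: valid_all_vars => e r Her; rewrite QE.
  have H : sat M e r (card_lt X Y) <->
      sat M e r (bound (ufield a) (card_lt_sigma X Y)).
    rewrite sat_card_lt // sat_card_lt_sigma //.
    by apply: card_ltP => //; apply: rels_reval Her _.
  by case: H.
have H : sat M e r (card_lt X Y) <->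
    sat M e r (bound (ufield a) (card_lt_pi X Y)).
  rewrite sat_card_lt // sat_card_lt_pi //.
  by apply: card_lt_not_leP => //; apply: rels_reval Her _.
by case: H.
Qed.

(** [injection] and [onto] do not refer to a model. Hence a non-surjective injection in [A] is still
    one in [B], and the absence of backward injections passes from [B] to [A], where it suffices by
    comparability. *)
Lemma domain_independent_card_lt : henkin_domain_independent sigma11_CA0_fin Q.
Proof.
move=> T A B CA CB [domAB relsAB _] e r HeA; rewrite QE.
have HeB : env_in B e r.
  by case: HeA => He Hr; split=> [x|n k]; [apply: domAB|apply: relsAB].
have MA (Z : rterm 1) : ~~ rocc 0 9 Z -> rels A 0 (reval r Z).
  exact: rels_reval HeA.
have MB (Z : rterm 1) : ~~ rocc 0 9 Z -> rels B 0 (reval r Z).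
  exact: rels_reval HeB.
rewrite !sat_card_lt //; split.
  move/(card_ltP CA (MA X NX) (MA Y NY)) => [f Af f_inj].
  by apply/(card_ltP CB (MB X NX) (MB Y NY)); exists f => //; apply: relsAB.
move=> [_ NB]; apply/(card_lt_not_leP CA (MA X NX) (MA Y NY)) => -[g Ag g_inj].
by apply: NB; exists g => //; apply: relsAB.
Qed.

(** Satisfaction of [card_lt] depends only on the values of its two terms. *)
Lemma conservative_card_lt (X' Y' : rterm 1) :
  Q (vars a) (map_tuple (RInter (ufield a)) (vars' a b)) = card_lt X' Y' ->
  (forall (T : Type) (r : renv T), reval r X' = reval r X) ->
  (forall (T : Type) (r : renv T), reval r Y' = reval r Y) ->
  henkin_conservative sigma11_CA0_fin Q.
Proof.
move=> QE' EX EY T M CA; apply: valid_all_vars => e r Her; rewrite QE QE'.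
have H : sat M e r (card_lt X Y) <-> sat M e r (card_lt X' Y').
  by rewrite !sat_card_lt // EX EY.
by case: H.
Qed.

End Quantifier.

(** * The two quantifiers at their variables, and the theorem *)

Lemma vars1E : vars 1 = [tuple RVar 0 0].
Proof. by apply: eq_from_tnth => i; rewrite tnth_mktuple (ord1 i). Qed.

Lemma vars2E : vars 2 = [tuple RVar 0 0; RVar 0 1].
Proof.
apply: eq_from_tnth => i; rewrite tnth_mktuple.
by case: (unliftP ord0 i) => [j ->|->] //; rewrite (ord1 j).
Qed.

Lemma vars'1E a : vars' a 1 = [tuple RVar 0 a].
Proof.
by apply: eq_from_tnth => i; rewrite tnth_mktuple (ord1 i) /= addn0.
Qed.

Lemma ufield1E : ufield 1 = RUnion (RField (RVar 0 0)) (REmpty 0).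
Proof. by rewrite /ufield vars1E. Qed.

Lemma ufield2E : ufield 2 =
  RUnion (RField (RVar 0 0)) (RUnion (RField (RVar 0 1)) (REmpty 0)).
Proof. by rewrite /ufield vars2E. Qed.

Lemma Most_vars : Most (vars 1) (vars' 1 1) =
  card_lt (RDiff (RVar 0 0) (RVar 0 1)) (RInter (RVar 0 0) (RVar 0 1)).
Proof. by rewrite vars1E vars'1E. Qed.

Lemma More_than_vars : More_than (vars 2) (vars' 2 1) =
  card_lt (RInter (RVar 0 1) (RVar 0 2)) (RInter (RVar 0 0) (RVar 0 2)).
Proof. by rewrite vars2E vars'1E. Qed.

Lemma Most_vars_ufield :
  Most (vars 1) (map_tuple (RInter (ufield 1)) (vars' 1 1)) =
  card_lt (RDiff (RVar 0 0) (RInter (ufield 1) (RVar 0 1)))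
          (RInter (RVar 0 0) (RInter (ufield 1) (RVar 0 1))).
Proof. by rewrite vars1E vars'1E. Qed.

Lemma More_than_vars_ufield :
  More_than (vars 2) (map_tuple (RInter (ufield 2)) (vars' 2 1)) =
  card_lt (RInter (RVar 0 1) (RInter (ufield 2) (RVar 0 2)))
          (RInter (RVar 0 0) (RInter (ufield 2) (RVar 0 2))).
Proof. by rewrite vars2E vars'1E. Qed.

Lemma reval_ufield1 (T : Type) (r : renv T) : reval r (ufield 1) = r 0 0.
Proof.
rewrite ufield1E -[LHS]/(reval r (RField (RVar 0 0)) `|` set0).
by rewrite reval_RField setU0.
Qed.

Lemma reval_ufield2 (T : Type) (r : renv T) :
  reval r (ufield 2) = r 0 0 `|` r 0 1.
Proof.
rewrite ufield2E -[LHS]/(reval r (RField (RVar 0 0)) `|`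
                         (reval r (RField (RVar 0 1)) `|` set0)).
by rewrite !reval_RField setU0.
Qed.

Theorem theorem12p1 :
  (bounded_delta11 sigma11_CA0_fin Most /\
   bounded_delta11 sigma11_CA0_fin More_than) /\
  (henkin_domain_independent sigma11_CA0_fin Most /\
   henkin_domain_independent sigma11_CA0_fin More_than /\
   henkin_conservative sigma11_CA0_fin Most /\
   henkin_conservative sigma11_CA0_fin More_than).
Proof.
split; [split|split; [|split; [|split]]].
- apply: (bounded_delta11_card_lt Most_vars) => //.
  + split; [by case=> [|[|[|x]]]|by case=> [|[|n]] [|[|k]]|].
    (* Nothing is captured: the bounding term contains only unary variables, while the formula binds
       only a binary one. *)
    by rewrite ufield1E; case=> [|n] k.
  + split; [by case=> [|[|[|x]]]|by case=> [|[|n]] [|[|k]]|].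
    by rewrite ufield1E; case=> [|n] k.
  + by rewrite ufield1E.
  + by move=> T r; rewrite reval_ufield1 => t [].
  + by move=> T r; rewrite reval_ufield1 => t [].
- apply: (bounded_delta11_card_lt More_than_vars) => //.
  + split; [by case=> [|[|[|x]]]|by case=> [|[|n]] [|[|[|k]]]|].
    by rewrite ufield2E; case=> [|n] k.
  + split; [by case=> [|[|[|x]]]|by case=> [|[|n]] [|[|[|k]]]|].
    by rewrite ufield2E; case=> [|n] k.
  + by rewrite ufield2E.
  + by move=> T r; rewrite reval_ufield2 => t []; right.
  + by move=> T r; rewrite reval_ufield2 => t []; left.
- exact: (domain_independent_card_lt Most_vars).
- exact: (domain_independent_card_lt More_than_vars).
- apply: (conservative_card_lt Most_vars Most_vars_ufield) => T r.
    (* The field is $F$, so the claim is $F\setminus(F\cap G)=F\setminus G$. *)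
    cbn -[ufield]; rewrite reval_ufield1; apply/seteqP; split=> t /= [Ft Nt].
      by split=> // Gt; apply: Nt.
    by split=> // -[].
  by cbn -[ufield]; rewrite reval_ufield1 setIA setIid.
(* Both identities are absorption: $G\cap(F\cup G)=G$ and $F\cap(F\cup G)=F$. *)
- apply: (conservative_card_lt More_than_vars More_than_vars_ufield) => T r;
    cbn -[ufield]; rewrite reval_ufield2 setIA; congr (_ `&` _);
    apply/setIidPl; [exact: subsetUr|exact: subsetUl].
Qed.
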